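(* If $f\in\mathbb R[x_1,\dots,x_n]$ is Lorentzian, then $f$ has the $\mathrm{HRR}_1$ with respect to $\ell_{\mathbf a}=a_1\partial_1+\dots+a_n\partial_n$ for every $\mathbf a\in\mathbb R^n_{>0}$.
   Context: A homogeneous $f\in\mathbb R_{\ge0}[x_1,\dots,x_n]$ of degree $d\ge2$ is Lorentzian if for every $(k_1,\dots,k_n)\in\mathbb Z_{\ge0}^n$ with $\sum k_i\le d-2$, $\partial_1^{k_1}\cdots\partial_n^{k_n}f$ is identically zero or its Hessian has exactly one positive eigenvalue at every point of $\mathbb R^n_{>0}$. Let $S=\mathbb R[\partial_1,\dots,\partial_n]$ act by differentiation; $R_f=S/\{D:Df=0\}$ graded, $[\,\cdot\,]:R_f^d\to\mathbb R$, $[D]=Df$. $f$ has the $\mathrm{HRR}_1$ w.r.t. a linear form $\ell$ if $\times\ell^{d-2}:R_f^1\to R_f^{d-1}$ is an isomorphism and the form $(\xi_1,\xi_2)\mapsto-[\xi_1\ell^{d-2}\xi_2]$ on $R_f^1$ is positive definite on the kernel of $\times\ell^{d-1}:R_f^1\to R_f^d$. *)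

(* Defs.v *)
From HB Require Import structures.
From mathcomp Require Import all_boot all_order all_algebra.
From mathcomp Require Import generic_quotient ring_quotient.
From mathcomp Require Import classical_sets functions reals.
From mathcomp Require Import ssrcomplements mpoly.

Set Implicit Arguments.
Unset Strict Implicit.
Unset Printing Implicit Defensive.

Import Order.TTheory GRing.Theory Num.Theory.

Local Open Scope ring_scope.
Local Open Scope quotient_scope.

Section Apolarity.
Variables (R : comNzRingType) (n : nat).
Implicit Types (D E f g : {mpoly R[n]}) (m : 'X_{1..n}).

(* The ring S = R[d_1, ..., d_n] of differential operators is again
   {mpoly R[n]}, the variable 'X_i standing for d_i. *)
Definition dact D f : {mpoly R[n]} := \sum_(m <- msupp D) D@_m *: f^`M[m].

Lemma dactE k D f : (msize D <= k)%N ->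
  dact D f = \sum_(m : 'X_{1..n < k}) D@_m *: f^`M[m].
Proof.
move=> leDk; rewrite /dact (big_mksub 'X_{1..n < k}) //=; first last.
- by move=> m /msize_mdeg_lt /leq_trans; apply.
- exact: msupp_uniq.
rewrite big_rmcond //= => m /memN_msupp_eq0 ->; exact: scale0r.
Qed.

Lemma dactDl D E f : dact (D + E) f = dact D f + dact E f.
Proof.
pose k := (msize D + (msize E + msize (D + E)))%N.
have leD : (msize D <= k)%N by rewrite leq_addr.
have leE : (msize E <= k)%N by rewrite /k addnCA leq_addr.
have leDE : (msize (D + E) <= k)%N by rewrite /k addnA leq_addl.
rewrite (dactE _ leD) (dactE _ leE) (dactE _ leDE).
by rewrite -big_split /=; apply: eq_bigr => m _; rewrite mcoeffD scalerDl.
Qed.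

Lemma dactZl c D f : dact (c *: D) f = c *: dact D f.
Proof.
pose k := (msize D + msize (c *: D))%N.
rewrite !(@dactE k) ?/k ?leq_addr ?leq_addl // scaler_sumr.
by apply: eq_bigr => m _; rewrite mcoeffZ scalerA.
Qed.

Lemma dact0l f : dact 0 f = 0.
Proof. by rewrite /dact msupp0 big_nil. Qed.

Lemma dactNl D f : dact (- D) f = - dact D f.
Proof. by rewrite -!scaleN1r dactZl. Qed.

Lemma dactX m f : dact 'X_[m] f = f^`M[m].
Proof. by rewrite /dact msuppX big_seq1 mcoeffX eqxx scale1r. Qed.

Lemma dact1 f : dact 1 f = f.
Proof. by rewrite -mpolyX0 dactX mderivm0m. Qed.

Lemma dact_suml (I : Type) (r : seq I) (F : I -> {mpoly R[n]}) f :
  dact (\sum_(i <- r) F i) f = \sum_(i <- r) dact (F i) f.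
Proof.
elim: r => [|i r IHr]; first by rewrite !big_nil dact0l.
by rewrite !big_cons dactDl IHr.
Qed.

Lemma dact0r D : dact D 0 = 0.
Proof. by rewrite /dact big1 // => m _; rewrite raddf0 scaler0. Qed.

Lemma dactM D E f : dact (D * E) f = dact D (dact E f).
Proof.
rewrite {1}(mpolyE D) mulr_suml dact_suml {2}/dact; apply: eq_bigr => m _.
rewrite -scalerAl dactZl; congr (_ *: _).
rewrite {1}(mpolyE E) mulr_sumr dact_suml {2}/dact raddf_sum.
apply: eq_bigr => m' _ /=.
by rewrite -scalerAr dactZl -mpolyXD dactX addmC mderivmDm mderivmZ.
Qed.

Definition ann f : {pred {mpoly R[n]}} := fun D => dact D f == 0.

Fact ann_zmod_closed f : zmod_closed (ann f).
Proof.
split=> [|D E]; rewrite !unfold_in ?dact0l //.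
by move=> /eqP DE /eqP EE; rewrite dactDl dactNl DE EE subr0.
Qed.

HB.instance Definition _ f :=
  GRing.isZmodClosed.Build _ (ann f) (ann_zmod_closed f).

(* R_f = S / Ann(f).  The library's {ideal_quot _} requires a proper ideal,
   whereas Ann(f) = S when f = 0; hence the ring structure, on top of the
   library's quotient of Z-modules, is only that of a possibly zero ring. *)
Definition apolar f : Type := Quotient.quot (ann f).

HB.instance Definition _ f := GRing.Zmodule.on (apolar f).

Definition apolar_pi f D : apolar f := \pi_(Quotient.quot (ann f)) D.
Definition apolar_repr f (x : apolar f) : {mpoly R[n]} :=
  repr (x : Quotient.quot (ann f)).
Definition apolar_one f : apolar f := apolar_pi f 1.
Definition apolar_mul f (x y : apolar f) : apolar f :=
  apolar_pi f (apolar_repr x * apolar_repr y).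

Lemma apolar_reprK f (x : apolar f) : apolar_pi f (apolar_repr x) = x.
Proof. exact: reprK. Qed.

Lemma apolar_piP f D E : (apolar_pi f D = apolar_pi f E) <-> dact D f = dact E f.
Proof.
have := Quotient.idealrBE (ann f) D E.
rewrite unfold_in /ann dactDl dactNl subr_eq0 => eqDE.
split=> [eqpi | eqact].
  by apply/eqP; rewrite eqDE; apply/eqP.
by apply/eqP; rewrite -[_ == _]eqDE eqact eqxx.
Qed.

Lemma dact_repr f D : dact (apolar_repr (apolar_pi f D)) f = dact D f.
Proof. by apply/apolar_piP; rewrite apolar_reprK. Qed.

Lemma apolar_piM f D E :
  apolar_pi f (D * E) = apolar_mul (apolar_pi f D) (apolar_pi f E).
Proof.
apply/apolar_piP; rewrite [RHS]dactM dact_repr -dactM [in RHS]mulrC.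
by rewrite [RHS]dactM dact_repr -dactM mulrC.
Qed.

Fact apolar_mulA f : associative (@apolar_mul f).
Proof.
move=> x y z; rewrite -[x]apolar_reprK -[y]apolar_reprK -[z]apolar_reprK.
by rewrite -!apolar_piM mulrA.
Qed.

Fact apolar_mulC f : commutative (@apolar_mul f).
Proof. by move=> x y; rewrite /apolar_mul mulrC. Qed.

Fact apolar_mul1 f : left_id (apolar_one f) (@apolar_mul f).
Proof. by move=> x; rewrite -[x]apolar_reprK -apolar_piM mul1r. Qed.

Fact apolar_piD f : {morph apolar_pi f : D E / D + E}.
Proof. by move=> D E; rewrite /apolar_pi raddfD. Qed.

Fact apolar_mulD f : left_distributive (@apolar_mul f) +%R.
Proof.
move=> x y z; rewrite -[x]apolar_reprK -[y]apolar_reprK -[z]apolar_reprK.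
by rewrite -apolar_piD -!apolar_piM mulrDl apolar_piD.
Qed.

HB.instance Definition _ f := GRing.Zmodule_isComPzRing.Build (apolar f)
  (@apolar_mulA f) (@apolar_mulC f) (@apolar_mul1 f) (@apolar_mulD f).

Definition apolar_deg f (k : nat) : set (apolar f) :=
  (apolar_pi f @` [set D | D \is k.-homog])%classic.

(* [D] = D f.  For D of degree d = deg f, D f is a constant polynomial and its
   constant coefficient is this constant; the value is irrelevant on elements
   of other degrees. *)
Definition apolar_bracket f (x : apolar f) : R := (dact (apolar_repr x) f)@_0.

Lemma apolar_bracketE f D : apolar_bracket (apolar_pi f D) = (dact D f)@_0.
Proof. by rewrite /apolar_bracket dact_repr. Qed.

End Apolarity.

Arguments apolar_deg {R n} f k.

Section Lorentzian.
Variables (R : realType) (n : nat).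
Implicit Types (f l : {mpoly R[n]}) (a : 'I_n -> R).

Definition hessian f a : 'M[R]_n := \matrix_(i, j) (f^`M(i)^`M(j)).@[a].

(* Eigenvalues are counted with multiplicity. *)
Definition one_pos_eigenvalue (A : 'M[R]_n) : Prop :=
  exists lam : R,
    [/\ 0 < lam, mup lam (char_poly A) = 1%N &
        forall mu : R, 0 < mu -> eigenvalue A mu -> mu = lam].

Definition lorentzian (d : nat) f : Prop :=
  [/\ (2 <= d)%N, f \is d.-homog, forall m, 0 <= f@_m &
      forall k : 'X_{1..n}, (mdeg k <= d - 2)%N ->
        f^`M[k] = 0 \/
        forall a, (forall i, 0 < a i) -> one_pos_eigenvalue (hessian f^`M[k] a)].

Definition HRR1 (d : nat) f l : Prop :=
  let L := apolar_pi f l in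
  set_bij (apolar_deg f 1) (apolar_deg f (d - 1)) (fun xi => xi * L ^+ (d - 2))
  /\ forall xi : apolar f, apolar_deg f 1 xi -> xi * L ^+ (d - 1) = 0 ->
       xi <> 0 -> 0 < - apolar_bracket (xi * L ^+ (d - 2) * xi).

Definition ell a : {mpoly R[n]} := \sum_(i < n) a i *: 'X_i.

End Lorentzian.

(* Main.v *)
Require Import Defs.
From mathcomp Require Import all_boot all_order all_algebra.
From mathcomp Require Import spectral.
From mathcomp Require Import classical_sets reals mpoly.
From mathcomp Require Import complex ring.

(* The form of HRR_1 is, up to the factor (d-2)!, the Hessian of f at a, and by
   Euler's identity the kernel of l_a^(d-1) is the orthogonal of a for it.
   A symmetric matrix with one positive eigenvalue is negative semidefinite on
   the orthogonal of a vector of positive norm, where its only null vectors are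
   those of its kernel.  So everything reduces to the claim that a vector c in
   the kernel of Hess_f(a) satisfies (sum_i c_i d_i) f = 0.  By induction on d:
   (d-2) Hess_f(a) = sum_i a_i Hess_(d_i f)(a), and c is orthogonal to a for
   each Hess_(d_i f)(a), so the numbers c^T Hess_(d_i f)(a) c are nonpositive;
   their positive combination (d-2) c^T Hess_f(a) c vanishes, so they all do and
   c lies in the kernel of every Hess_(d_i f)(a). *)

Set Implicit Arguments.
Unset Strict Implicit.
Unset Printing Implicit Defensive.

Import Order.TTheory GRing.Theory Num.Theory.
Local Open Scope ring_scope.

(** * Diagonal Hermitian forms with at most one positive coefficient *)

Section DiagonalForm.
Variables (C : numClosedFieldType) (n : nat) (d : 'I_n -> C).
Hypothesis d_real : forall i, d i \is Num.real.
Hypothesis d_pos_uniq : forall i j, 0 < d i -> 0 < d j -> i = j.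

Let q (z w : 'I_n -> C) : C := \sum_i d i * (z i * (w i)^*).

(** Reverse Cauchy-Schwarz argument. Let [k] be the index of the positive coefficient. The
    combination [t] of [z] and [w] has zero [k]-th coordinate, so [q t t <= 0], while orthogonality
    removes the cross terms of [q t t]. *)
Lemma diag_form_orthogonal (z w : 'I_n -> C) : 0 < q z z -> q w z = 0 ->
  q w w <= 0 /\ (q w w = 0 -> forall i, w i * d i = 0).
Proof.
move=> qzz qwz.
have [k dk_gt0] : exists k, 0 < d k.
  apply/existsP; apply: contraTT qzz => /existsPn dN.
  rewrite real_ltNge ?real0 ?negbK //; last first.
    by apply: sum_real => i _; rewrite realM ?d_real ?ger0_real ?mul_conjC_ge0.
  apply: sumr_le0 => i _; rewrite mulr_le0_ge0 ?mul_conjC_ge0 //.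
  by rewrite real_leNgt ?real0.
have d_le0 i : i != k -> d i <= 0.
  move=> nik; rewrite real_leNgt ?real0 //.
  by apply: contra nik => di; apply/eqP/d_pos_uniq.
have q_le0 t : t k = 0 -> q t t <= 0.
  move=> tk0; apply: sumr_le0 => i _; have [->|nik] := eqVneq i k.
    by rewrite tk0 mul0r mulr0.
  by rewrite mulr_le0_ge0 ?mul_conjC_ge0 ?d_le0.
have zk_neq0 : z k != 0.
  by apply: contraTneq qzz => /q_le0 /le_gtF ->.
have qzw : q z w = 0.
  rewrite -[RHS]conjC0 -qwz rmorph_sum; apply: eq_bigr => i _ /=.
  by rewrite !rmorphM /= conjCK (CrealP (d_real i)) [in RHS](mulrC _ (z i)).
pose t i := z k * w i - w k * z i.
have qtt : q t t = z k * (z k)^* * q w w + w k * (w k)^* * q z z.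
  have -> : q t t = z k * (z k)^* * q w w + w k * (w k)^* * q z z
      - (z k * (w k)^* * q w z + w k * (z k)^* * q z w).
    rewrite /q !mulr_sumr -!big_split /= -sumrB; apply: eq_bigr => i _.
    by rewrite /t rmorphB !rmorphM /=; ring.
  by rewrite qwz qzw !mulr0 addr0 subr0.
have qtt_le0 : q t t <= 0 by apply: q_le0; rewrite /t mulrC subrr.
have zk_gt0 : 0 < z k * (z k)^* by rewrite mul_conjC_gt0.
have qww_le0 : q w w <= 0.
  rewrite -(pmulr_rle0 _ zk_gt0); apply: le_trans qtt_le0.
  by rewrite qtt lerDl mulr_ge0 ?mul_conjC_ge0 // ltW.
split=> // qww0 i.
(* When [q w w = 0], only the term in [q z z > 0] remains in [q t t <= 0], forcing [w k = 0]. Then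
   [q w w] is a sum of nonpositive terms, all of which vanish. *)
have wk0 : w k = 0.
  move: qtt_le0; rewrite qtt qww0 mulr0 add0r pmulr_lle0 //.
  move=> wk_le0; apply/eqP; rewrite -mul_conjC_eq0 eq_le wk_le0.
  exact: mul_conjC_ge0.
have term_le0 j : true -> 0 <= - (d j * (w j * (w j)^*)).
  move=> _; rewrite oppr_ge0; have [->|njk] := eqVneq j k.
    by rewrite wk0 mul0r mulr0.
  by rewrite mulr_le0_ge0 ?mul_conjC_ge0 ?d_le0.
have sum0 : \sum_j - (d j * (w j * (w j)^*)) = 0
  by rewrite sumrN -/(q w w) qww0 oppr0.
move/eqP: (psumr_eq0P term_le0 sum0 (i := i) isT).
rewrite oppr_eq0 mulrA mulf_eq0 mulf_eq0 conjC_eq0.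
by move=> /orP[/orP[]|] /eqP->; rewrite ?mulr0 ?mul0r.
Qed.
End DiagonalForm.

(** * Real symmetric matrices with one positive eigenvalue *)

Lemma char_poly_similar (F : fieldType) (m : nat) (P A : 'M[F]_m) :
  P \in unitmx -> char_poly (invmx P *m A *m P) = char_poly A.
Proof.
move=> uP; have uPX : map_mx polyC P \in unitmx by rewrite map_unitmx.
rewrite /char_poly.
have -> : char_poly_mx (invmx P *m A *m P) =
    invmx (map_mx polyC P) *m char_poly_mx A *m map_mx polyC P.
  rewrite /char_poly_mx mulmxBr mulmxBl !map_mxM /= map_invmx; congr (_ - _).
  by rewrite scalar_mxC -mulmxA mulVmx ?mulmx1.
rewrite !det_mulmx mulrC mulrA -det_mulmx.
by rewrite mulmxV // det1 mul1r.
Qed.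

Local Open Scope sesquilinear_scope.

(** Over [R[i]] a real symmetric matrix is Hermitian, hence unitarily diagonalizable with real
    eigenvalues. *)
Lemma symmetric_spectral (R : rcfType) (n : nat) (A : 'M[R]_n) : A^T = A ->
  exists (P : 'M[R[i]]_n) (d : 'rV[R[i]]_n),
    [/\ P \is unitarymx, d \is a realmx &
        map_mx (real_complex R) A = P^t* *m diag_mx d *m P].
Proof.
move=> symA; have hA : map_mx (real_complex R) A \is hermsymmx.
  apply: realsym_hermsym; last first.
    by apply/mxOverP => i j; rewrite mxE; apply/complex_realP; eexists.
  by apply/is_hermitianmxP; rewrite expr0 scale1r map_mx_id // map_trmx symA.
exists (spectralmx (map_mx (real_complex R) A)).
exists (spectral_diag (map_mx (real_complex R) A)).
rewrite spectral_unitarymx hermitian_spectral_diag_real //; split=> //.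
rewrite -invmx_unitary ?spectral_unitarymx //.
exact/orthomx_spectralP/hermitian_normalmx.
Qed.

Section OnePositiveEigenvalue.
Variables (R : realType) (n : nat).
Local Notation toC := (map_mx (real_complex R)).

(** Coordinates in a unitary eigenbasis reduce this to [diag_form_orthogonal]; the work is to turn a
    simple root of the characteristic polynomial into a single positive diagonal entry. *)
Lemma one_pos_eigenvalue_orthogonal (A : 'M[R]_n) (u v : 'rV[R]_n) :
    A^T = A -> one_pos_eigenvalue A ->
    0 < (u *m A *m u^T) 0 0 -> (v *m A *m u^T) 0 0 = 0 ->
  (v *m A *m v^T) 0 0 <= 0 /\ ((v *m A *m v^T) 0 0 = 0 -> v *m A = 0).
Proof.
move=> symA [lam [lam_gt0 mup_lam lam_uniq]] uAu vAu.
have [P [d [uP /mxOverP rd eqA]]] := symmetric_spectral symA.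
have uuP := unitarymx_unit uP.
have char_A : map_poly (real_complex R) (char_poly A) =
    \prod_i ('X - (d 0 i)%:P).
  rewrite map_char_poly eqA -invmx_unitary // char_poly_similar //.
  rewrite char_poly_trig ?diag_mx_is_trig //.
  by apply: eq_bigr => i _; rewrite mxE eqxx mulr1n.
have d_pos i : 0 < d 0 i -> d 0 i = (lam%:C)%C.
  have /complex_realP[r dr] := rd 0 i; rewrite dr ltcR => r_gt0; congr (_%:C)%C.
  apply: lam_uniq => //.
  rewrite eigenvalue_root_char -(fmorph_root (real_complex R)).
  rewrite char_A; apply/rootP; rewrite horner_prod (bigD1 i) //= dr.
  by rewrite !hornerE subrr mul0r.
have d_uniq i j : 0 < d 0 i -> 0 < d 0 j -> i = j.
  move=> /d_pos di /d_pos dj; apply/eqP; apply: contraPT mup_lam => nij.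
  (* Two positive diagonal entries would both equal [lam], so the square of ['X - lam%:P] would
     divide the characteristic polynomial. *)
  suff : (2 <= mup lam (char_poly A))%N by case: mup => [|[]].
  rewrite mup_geq ?monic_neq0 ?char_poly_monic //.
  rewrite -(dvdp_map (real_complex R)) char_A rmorphXn rmorphB /=.
  rewrite map_polyX map_polyC.
  rewrite (bigD1 i) //= (bigD1 j) 1?eq_sym //= di dj mulrA.
  exact: dvdp_mulIl.
pose co (x : 'rV[R]_n) i := (toC x *m P^t*) 0 i.
have formE x y : (((x *m A *m y^T) 0 0)%:C)%C =
    \sum_i d 0 i * (co x i * (co y i)^*) :> R[i].
  have -> : (((x *m A *m y^T) 0 0)%:C)%C = (toC (x *m A *m y^T)) 0 0
    by rewrite [in RHS]mxE.
  have PtP : P^t* *m P = 1%:M by rewrite -invmx_unitary // mulVmx.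
  have yE : toC y^T = P^t* *m (toC y *m P^t*)^t*.
    rewrite trmx_mul map_mxM /= trmxCK mulmxA PtP mul1mx.
    by apply/matrixP => i j; rewrite !mxE; apply/esym/conjc_real.
  rewrite !map_mxM /= eqA yE !mulmxA mulmxtVK // /co.
  move: (toC x *m P^t*) (toC y *m P^t*) => X Y.
  rewrite mxE mul_mx_diag; apply: eq_bigr => i _.
  by rewrite !mxE mulrA [X 0 i * _]mulrC.
have [] := @diag_form_orthogonal _ n (d 0) _ d_uniq (co u) (co v).
- by move=> i; apply: rd.
- by rewrite -formE ltcR.
- by rewrite -formE vAu.
rewrite -formE lecR => vAv_le0 vAv_eq0; split=> //.
move=> /(congr1 (real_complex R)) /vAv_eq0 vd0.
apply: (map_mx_inj (f := real_complex R)).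
rewrite map_mxM /= eqA map_mx0 !mulmxA mul_mx_diag.
suff -> : \matrix_(i, j) ((toC v *m P^t*) i j * d 0 j) = 0 :> 'rV__
  by rewrite mul0mx.
by apply/matrixP => i j; rewrite ord1 mxE [RHS]mxE; exact: vd0.
Qed.
End OnePositiveEigenvalue.

(** * Homogeneity, Euler's identity and classes of operators *)

Section Apolarity.
Variables (R : comNzRingType) (n : nat).
Implicit Types (f g D : {mpoly R[n]}).

Lemma dact_Xi i g : dact 'X_i g = g^`M(i).
Proof. by rewrite dactX mderivmU1m. Qed.

Lemma dact_mderiv D i g : dact D g^`M(i) = (dact D g)^`M(i).
Proof. by rewrite -!dact_Xi -!dactM mulrC. Qed.

Lemma dhomog_dact k e D g : D \is k.-homog -> g \is (k + e).-homog ->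
  dact D g \is e.-homog.
Proof.
move=> /dhomogP homD /dhomogP homg; rewrite /dact big_seq.
apply: rpred_sum => m Dm.
rewrite rpredZ //; apply/dhomogP => m'.
rewrite mcoeff_msupp mcoeff_mderivm => gm.
have /homg : (m + m')%MM \in msupp g.
  by rewrite mcoeff_msupp; apply: contraNneq gm => ->; rewrite mul0rn.
by rewrite /= mdegD (homD _ Dm) => /addnI.
Qed.

Lemma dhomog_mderiv k i g : g \is k.+1.-homog -> g^`M(i) \is k.-homog.
Proof.
by rewrite -add1n -dact_Xi; apply: dhomog_dact; rewrite dhomogX /= mdeg1.
Qed.

Lemma euler_homog k g : g \is k.-homog -> \sum_i 'X_i * g^`M(i) = k%:R *: g.
Proof.
move=> /dhomogP homg; rewrite [g in RHS]mpolyE scaler_sumr.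
under eq_bigr do rewrite /mderiv mulr_sumr.
rewrite exchange_big /= big_seq [RHS]big_seq; apply: eq_bigr => m /homg /= <-.
rewrite mdegE natr_sum scaler_suml; apply: eq_bigr => i _.
rewrite -scalerAr -scalerA !scalerA.
have [->|mi_neq0] := eqVneq (m i) 0%N; first by rewrite mul0r !scale0r.
by rewrite -mpolyXD addmC submK // lep1mP.
Qed.

Lemma dhomog0_const g : g \is 0.-homog -> g = (g@_0)%:MP.
Proof.
move=> homg; apply/mpolyP => m; rewrite mcoeffC.
have [->|nm0] := eqVneq m 0%MM; first by rewrite mulr1.
by rewrite mulr0 (dhomog_nemf_coeff homg) //= mdeg_eq0.
Qed.

Lemma apolar_piX f D k : apolar_pi f (D ^+ k) = apolar_pi f D ^+ k.
Proof.
by elim: k => [//|k IHk]; rewrite !exprS apolar_piM IHk.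
Qed.

Lemma apolar_pi_eq0 f D : apolar_pi f D = 0 <-> dact D f = 0.
Proof.
have -> : (0 : apolar f) = apolar_pi f 0 by rewrite /apolar_pi raddf0.
by rewrite -[X in _ <-> _ = X](dact0l f); exact: apolar_piP.
Qed.

End Apolarity.

Section OrderedCoefficients.
Variables (R : numDomainType) (n : nat).
Implicit Types (g : {mpoly R[n]}) (a : 'I_n -> R).

(** Euler's identity gives [k.+1%:R *: g = 0]; positive degree rules out nonzero constants. *)
Lemma dhomog_mderiv_eq0 k g : g \is k.+1.-homog ->
  (forall i, g^`M(i) = 0) -> g = 0.
Proof.
move=> /euler_homog eul dg0; apply/eqP.
have := eul; rewrite big1 => [/esym/eqP|i _]; last by rewrite dg0 mulr0.
by rewrite -mul_mpolyC mulf_eq0 mpolyC_eq0 pnatr_eq0.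
Qed.

(** The leading monomial contributes a positive term and the others nonnegative ones. *)
Lemma meval_gt0 a g : (forall i, 0 < a i) -> (forall m, 0 <= g@_m) ->
  g != 0 -> 0 < g.@[a].
Proof.
move=> a_gt0 g_ge0 g_neq0; rewrite mevalE.
have mon_gt0 (m : 'X_{1..n}) : 0 < \prod_i a i ^+ m i.
  by apply: prodr_gt0 => i _; rewrite exprn_gt0.
have lead := mlead_supp g_neq0.
rewrite (bigD1_seq (mlead g)) ?msupp_uniq //= ltr_pwDl //.
  by rewrite mulr_gt0 // lt_def g_ge0 andbT -mcoeff_msupp.
by apply: sumr_ge0 => m _; rewrite mulr_ge0 // ltW.
Qed.

End OrderedCoefficients.

(** * Derivatives along a vector and powers of [ell a] *)

Section DirectionalDerivatives.
Variables (R : realType) (n : nat).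
Implicit Types (f g D : {mpoly R[n]}) (a c : 'I_n -> R).

Lemma dact_ell c g : dact (ell c) g = \sum_i c i *: g^`M(i).
Proof.
by rewrite /ell dact_suml; apply: eq_bigr => i _; rewrite dactZl dact_Xi.
Qed.

Lemma dhomog_ell c : ell c \is 1.-homog.
Proof.
by apply: rpred_sum => i _; rewrite rpredZ // dhomogX /= mdeg1.
Qed.

Lemma dhomog1_ell D : D \is 1.-homog -> exists c, D = ell c.
Proof.
move=> homD; exists (fun i => D@_U_(i)); apply/mpolyP => m.
rewrite raddf_sum /=.
have [/eqP/mdeg1P[i /eqP ->]|deg_m] := eqVneq (mdeg m) 1%N.
  rewrite (bigD1 i) //= mcoeffZ mcoeffXU eqxx mulr1 big1 ?addr0 // => j nji.
  by rewrite mcoeffZ mcoeffXU (negPf nji) mulr0.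
rewrite (dhomog_nemf_coeff homD deg_m) big1 // => i _; rewrite mcoeffZ mcoeffX.
by case: (_ =P m) deg_m => [<-|]; rewrite ?mdeg1 ?mulr0.
Qed.

Lemma dhomog_dact_ell k c g : g \is k.+1.-homog -> dact (ell c) g \is k.-homog.
Proof. by rewrite -add1n; apply: dhomog_dact (dhomog_ell c). Qed.

Lemma euler_eval k a g : g \is k.-homog ->
  (dact (ell a) g).@[a] = k%:R * g.@[a].
Proof.
move=> /euler_homog /(congr1 (meval a)); rewrite mevalZ => <-.
rewrite dact_ell !raddf_sum /=; apply: eq_bigr => i _.
by rewrite mevalZ mevalM mevalXU.
Qed.

(** Iterated Euler identity: each [ell a] lowers the degree by one and multiplies the value at [a]
    by the degree. It turns products in the apolar ring into evaluations at [a]. *)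
Lemma dact_ell_exp k a g : g \is k.-homog ->
  dact (ell a ^+ k) g = (k`!%:R * g.@[a])%:MP.
Proof.
elim: k g => [|k IHk] g homg.
  by rewrite expr0 dact1 mul1r {1 2}(dhomog0_const homg) mevalC.
rewrite exprSr dactM IHk ?dhomog_dact_ell // (euler_eval _ homg) mulrA.
by rewrite -natrM factS mulnC.
Qed.

End DirectionalDerivatives.

(** * The Hessian of a Lorentzian polynomial and its kernel *)

Section LorentzianKernel.
Variables (R : realType) (n : nat).
Implicit Types (f g : {mpoly R[n]}) (a b c : 'I_n -> R).

Lemma lorentzian_mderiv d f i : (2 <= d)%N -> lorentzian d.+1 f ->
  lorentzian d f^`M(i).
Proof.
move=> d_ge2 [_ homf f_ge0 f_hess]; split=> //.
- exact: dhomog_mderiv.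
- by move=> m; rewrite mcoeff_mderiv mulrn_wge0.
move=> k deg_k; rewrite -mderivmU1m -mderivmDm; apply: f_hess.
by rewrite mdegD mdeg1 add1n subSn // ltnS.
Qed.

Lemma hessian_sym f a : (hessian f a)^T = hessian f a.
Proof. by apply/matrixP => i j; rewrite !mxE mderiv_comm. Qed.

Lemma mul_hessian f a c j :
  ((\row_i c i) *m hessian f a) 0 j = ((dact (ell c) f)^`M(j)).@[a].
Proof.
rewrite mxE dact_ell (raddf_sum (mderiv j)) raddf_sum /=; apply: eq_bigr => i _.
by rewrite !mxE mderivZ mevalZ.
Qed.

Lemma hessian_form f a c b :
  ((\row_i c i) *m hessian f a *m (\row_i b i)^T) 0 0 =
    (dact (ell b) (dact (ell c) f)).@[a].
Proof.
rewrite mxE [in RHS]dact_ell raddf_sum /=; apply: eq_bigr => j _.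
by rewrite mul_hessian mevalZ mulrC !mxE.
Qed.

(** By Euler, the Hessian form pairs [a] with itself to [d * (d - 1)] times [f.@[a]], and [c] with
    [a] to [d - 1] times [(dact (ell c) f).@[a]]. So [a] is a vector of positive norm unless
    [f = 0], and the hypothesis says that [c] is orthogonal to it. *)
Lemma lorentzian_orthogonal d f a c : lorentzian d f -> (forall i, 0 < a i) ->
    (dact (ell c) f).@[a] = 0 ->
  (dact (ell c) (dact (ell c) f)).@[a] <= 0 /\
  ((dact (ell c) (dact (ell c) f)).@[a] = 0 ->
     forall j, ((dact (ell c) f)^`M(j)).@[a] = 0).
Proof.
case: d => [|[|d]] [//= _ homf f_ge0 f_hess] a_gt0 cf0.
have [->|f_neq0] := eqVneq f 0.
  by rewrite !dact0r meval0; split=> // _ j; rewrite mderiv0 meval0.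
have [|f0|/(_ a a_gt0)] := f_hess 0%MM; first by rewrite mdeg0.
  by move: f0 f_neq0; rewrite mderivm0m => ->; rewrite eqxx.
rewrite mderivm0m => one_pos.
have := one_pos_eigenvalue_orthogonal (u := \row_i a i) (v := \row_i c i)
  (hessian_sym f a) one_pos.
rewrite !hessian_form => -[].
- have homaf := dhomog_dact_ell a homf.
  rewrite (euler_eval _ homaf) (euler_eval _ homf) !mulr_gt0 ?ltr0n //.
  exact: meval_gt0.
- by rewrite (euler_eval _ (dhomog_dact_ell c homf)) cf0 mulr0.
move=> le0 eq0; split=> // /eq0 /matrixP cH j.
by rewrite -mul_hessian cH mxE.
Qed.

Lemma lorentzian_hessian_kernel d f a c : lorentzian d f ->
    (forall i, 0 < a i) -> (forall j, ((dact (ell c) f)^`M(j)).@[a] = 0) ->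
  dact (ell c) f = 0.
Proof.
move=> + a_gt0; elim: d f => [|d IHd] f lorf Hc0; first by case: lorf.
have [d_ge2 homf f_ge0 f_hess] := lorf.
have homcf := dhomog_dact_ell c homf.
(* As [f] has degree [d.+1], the first case is that of quadratic forms: the derivatives of
   [dact (ell c) f] are constants, known from their values at [a]. *)
have [d_le1|d_gt1] := leqP d 1.
  have eq_d : d = 1%N by apply/eqP; rewrite eqn_leq d_le1.
  subst d; apply: (dhomog_mderiv_eq0 homcf) => j.
  have hom0 := dhomog_mderiv j homcf.
  by move: (Hc0 j); rewrite (dhomog0_const hom0) mevalC => ->; rewrite mpolyC0.
case: d d_gt1 {d_ge2 f_ge0 f_hess} => // d d_gt1 in IHd lorf homf homcf *.
apply: (dhomog_mderiv_eq0 homcf) => j; rewrite -dact_mderiv.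
pose q j := (dact (ell c) (dact (ell c) f^`M(j))).@[a].
have orth i := @lorentzian_orthogonal _ f^`M(i) a c
  (lorentzian_mderiv i d_gt1 lorf) a_gt0.
(* Orthogonality of [c] to [a] for the [i]-th derivative is the [i]-th equation of [Hc0], since
   operators commute. *)
have q_le0 i : q i <= 0 by apply: (orth i _).1; rewrite dact_mderiv.
(* Euler's identity for the second derivative of [f] along [c], whose value at [a] is zero by [Hc0].
   The sign makes every term nonnegative. *)
have sum_q : \sum_i a i * - q i = 0.
  have := euler_eval a (dhomog_dact_ell c homcf).
  rewrite [in LHS]dact_ell raddf_sum /=.
  have -> : (dact (ell c) (dact (ell c) f)).@[a] = 0.
    by rewrite dact_ell raddf_sum /= big1 // => i _; rewrite mevalZ Hc0 mulr0.
  rewrite mulr0 => /eqP; rewrite -oppr_eq0 -sumrN => /eqP sum0.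
  rewrite -[RHS]sum0.
  by apply: eq_bigr => i _; rewrite mevalZ mulrN /q !dact_mderiv.
have q0 i : q i = 0.
  have term_ge0 k : true -> 0 <= a k * - q k.
    by rewrite mulr_ge0 ?oppr_ge0 // ltW.
  move/eqP: (psumr_eq0P term_ge0 sum_q (i := i) isT).
  by rewrite mulf_eq0 oppr_eq0 gt_eqF //= => /eqP.
apply: IHd; first exact: lorentzian_mderiv.
by apply: (orth j _).2; [rewrite dact_mderiv | exact: q0].
Qed.

End LorentzianKernel.

(** * The Hodge-Riemann relations in degree one *)

Theorem theorem3p8 (R : realType) (n d : nat) (f : {mpoly R[n]})
    (f_lorentzian : lorentzian d f) (a : 'I_n -> R)
    (a_pos : forall i, 0 < a i) :
  HRR1 d f (ell a).
Proof.
have [] := f_lorentzian; case: d f_lorentzian => [|[|d]] // lorf _ homf _ _.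
have homl k : ell a ^+ k \is k.-homog.
  by rewrite -[k in k.-homog]mul1n dhomogMn ?dhomog_ell.
have piMX D k : apolar_pi f D * apolar_pi f (ell a) ^+ k =
    apolar_pi f (D * ell a ^+ k).
  by rewrite apolar_piM apolar_piX.
have fact_neq0 k : k`!%:R != 0 :> R by rewrite pnatr_eq0 -lt0n fact_gt0.
(* From here on the degree of [f] is [d.+2], so the derivative of [dact (ell c) f] has degree [d]
   and [ell a ^+ d] sends it to a constant. *)
have mderiv_ell c j : (dact (ell c * ell a ^+ d) f)^`M(j) =
    (d`!%:R * ((dact (ell c) f)^`M(j)).@[a])%:MP.
  rewrite mulrC dactM -dact_mderiv dact_ell_exp //.
  by rewrite dhomog_mderiv // dhomog_dact_ell.
have kernel c : dact (ell c * ell a ^+ d) f = 0 -> dact (ell c) f = 0.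
  move=> cl0; apply: (lorentzian_hessian_kernel lorf a_pos) => j.
  move/eqP: (mderiv_ell c j); rewrite cl0 mderiv0 eq_sym mpolyC_eq0 mulf_eq0.
  by rewrite (negPf (fact_neq0 d)) => /eqP.
rewrite /HRR1 !subSS !subn0; split; first split.
- move=> _ [D homD <-]; rewrite piMX; exists (D * ell a ^+ d) => //=.
  by rewrite -add1n dhomogM.
(* Injectivity: two representatives differ by some [ell c], to which [kernel] applies. *)
- move=> x y /set_mem[D homD <-] /set_mem[E homE <-].
  rewrite !piMX => /apolar_piP eqDE; apply/apolar_piP; apply/eqP.
  have [c DE] : exists c, D - E = ell c by apply: dhomog1_ell; rewrite rpredB.
  rewrite -subr_eq0 -dactNl -dactDl DE; apply/eqP/kernel.
  by rewrite -DE mulrBl dactDl dactNl eqDE subrr.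
- move=> _ [D homD <-].
  (* Surjectivity amounts to solving [x *m H = b] up to a scalar, where [b] lists the coefficients
     of the linear form [dact D f]. It is solvable once [b] annihilates the cokernel: as [H] is
     symmetric, each column [c] of [cokermx H] lies in its kernel, so [dact (ell c) f = 0] and [b]
     pairs with [c] to zero. *)
  pose H := hessian f a.
  pose b := \row_j ((dact D f)^`M(j))@_0.
  have /submxP[x xH] : (b <= H)%MS.
    rewrite submxE; apply/eqP/matrixP => i k; rewrite ord1 [RHS]mxE.
    pose c j := cokermx H j k.
    have cf0 : dact (ell c) f = 0.
      apply: (lorentzian_hessian_kernel lorf a_pos) => j.
      rewrite -mul_hessian -hessian_sym -/H.
      have /matrixP/(_ j k) := mulmx_coker H; rewrite [RHS]mxE => <-.
      rewrite !mxE; apply: eq_bigr => m _.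
      by rewrite mulrC; congr (_ * _); rewrite [LHS]mxE.
    have -> : (b *m cokermx H) 0 k = (dact (ell c) (dact D f))@_0.
      rewrite dact_ell raddf_sum mxE /=; apply: eq_bigr => j _.
      by rewrite mcoeffZ mulrC; congr (_ * _); rewrite mxE.
    by rewrite -dactM mulrC dactM cf0 dact0r mcoeff0.
  (* Dividing by the factorial cancels the factor in [mderiv_ell]. *)
  exists (apolar_pi f (ell (fun i => x 0 i / d`!%:R))).
    by exists (ell (fun i => x 0 i / d`!%:R)); rewrite //= dhomog_ell.
  rewrite piMX; apply/apolar_piP/eqP; rewrite -subr_eq0; apply/eqP.
  have homDf : dact D f \is 1.-homog
    by apply: dhomog_dact homD _; rewrite addn1.
  have homxf : dact (ell (fun i => x 0 i / d`!%:R) * ell a ^+ d) f \is 1.-homog.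
    by apply: (@dhomog_dact _ _ (1 + d)); rewrite ?dhomogM ?dhomog_ell // addn1.
  apply: (@dhomog_mderiv_eq0 _ _ 0) => [|j]; first by rewrite rpredB.
  rewrite mderivB mderiv_ell (dhomog0_const (dhomog_mderiv j homDf)).
  apply/eqP; rewrite subr_eq0 -mul_hessian; apply/eqP; congr _%:MP.
  have -> : ((dact D f)^`M(j))@_0 = b 0 j by rewrite mxE.
  rewrite xH !mxE mulr_sumr; apply: eq_bigr => i _.
  by rewrite !mxE mulrA mulrCA divff ?mulr1.
move=> _ [D homD <-] + /eqP.
have [c ->] := dhomog1_ell homD.
rewrite piMX => /apolar_pi_eq0.
(* The primitivity condition becomes [(dact (ell c) f).@[a] = 0], up to a nonzero factorial. *)
rewrite mulrC dactM dact_ell_exp ?dhomog_dact_ell //.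
move=> /eqP; rewrite mpolyC_eq0 mulf_eq0 (negPf (fact_neq0 _)) => /eqP cf0 nz.
have [q_le0 q0] := lorentzian_orthogonal lorf a_pos cf0.
rewrite piMX -[_ * apolar_pi _ _]apolar_piM apolar_bracketE mulrAC.
rewrite mulrC dactM dact_ell_exp; last first.
  by rewrite dactM !dhomog_dact_ell.
rewrite mcoeffC eqxx mulr1 dactM oppr_gt0 pmulr_rlt0; last first.
  by rewrite lt_def fact_neq0 ler0n.
(* Strictness: if the form vanished at [c], then [c] would lie in the kernel of the Hessian and the
   class of [ell c] would be zero. *)
rewrite lt_neqAle q_le0 andbT; apply: contraNneq nz => /q0 cf.
by apply/eqP/apolar_pi_eq0; apply: (lorentzian_hessian_kernel lorf a_pos).
Qed.
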